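(* Let $\alpha\in(0,1)$ be a constant, $r$ a positive integer and $\varepsilon\in\big(0,\alpha(1-\alpha)/4\big)$. Given a known quantum state $\sigma$ of rank $r$ and copies of an unknown quantum state $\rho$ promised to have rank at most $r$, any quantum algorithm estimating $\mathrm{D}^{\mathrm{T}}_\alpha(\rho\|\sigma)$ within additive error $\varepsilon$ (with success probability at least $2/3$) requires $\Omega(r/\varepsilon+1/\varepsilon^2)$ samples of $\rho$.
   Context: $\mathrm{D}^{\mathrm{T}}_\alpha(\rho\|\sigma)=\frac{1}{1-\alpha}\big(1-\operatorname{tr}(\rho^\alpha\sigma^{1-\alpha})\big)$ for density operators $\rho,\sigma$. *)

(* Defs.v *)
(* matrices over the complex numbers R[i] (R : realType),
   real powers via MathComp-Analysis's powR. *)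
From mathcomp Require Import all_boot all_algebra.
From mathcomp Require Import reals exp.
From mathcomp Require Import complex mxtens.
From Stdlib Require Import ClassicalEpsilon.
Import GRing.Theory Num.Theory.

Set Implicit Arguments.
Unset Strict Implicit.
Unset Printing Implicit Defensive.

Local Open Scope ring_scope.
Local Open Scope complex_scope.

Section Quantum.
Variable R : realType.
Local Notation C := R[i].

(* conjugate transpose *)
Definition adjmx {m n : nat} (A : 'M[C]_(m, n)) : 'M[C]_(n, m) :=
  (map_mx (fun z : C => z^*) A)^T.

(* positive semidefinite: <v, A v> is a nonnegative real for every v
   (over C this also forces A to be Hermitian) *)
Definition psdmx {d : nat} (A : 'M[C]_d) : Prop :=
  forall v : 'cV[C]_d, 0 <= (adjmx v *m A *m v) 0 0.

(* density operator (quantum state) on C^d *)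
Definition density {d : nat} (rho : 'M[C]_d) : Prop :=
  psdmx rho /\ \tr rho = 1.

Definition unitarymx {d : nat} (U : 'M[C]_d) : Prop :=
  adjmx U *m U = 1%:M.

(* spectral decompositions A = U diag(lam) U^* with lam >= 0 *)
Definition psd_spectral {d : nat} (A : 'M[C]_d)
  (Ul : 'M[C]_d * ('I_d -> R)) : Prop :=
  unitarymx Ul.1 /\ (forall i, 0 <= Ul.2 i) /\
  A = Ul.1 *m diag_mx (\row_i (Ul.2 i)%:C) *m adjmx Ul.1.

(* real power of a positive semidefinite matrix, defined through a (chosen)
   spectral decomposition: A^p = U diag(lam_i ^ p) U^*  (with 0^p = 0 for p<>0,
   i.e. the power is taken on the support) *)
Definition mxpowR {d : nat} (A : 'M[C]_d) (p : R) : 'M[C]_d :=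
  let Ul := epsilon (inhabits (1%:M, fun _ => 0)) (psd_spectral A) in
  Ul.1 *m diag_mx (\row_i (powR (Ul.2 i) p)%:C) *m adjmx Ul.1.

(* Tsallis relative entropy
   D^T_alpha(rho||sigma) = (1 - tr(rho^alpha sigma^(1-alpha))) / (1 - alpha) *)
Definition tsallisD {d : nat} (alpha : R) (rho sigma : 'M[C]_d) : R :=
  (1 - complex.Re (\tr (mxpowR rho alpha *m mxpowR sigma (1 - alpha))))
    / (1 - alpha).

(* a POVM with k outcomes on C^D *)
Definition povm {D k : nat} (M : 'I_k -> 'M[C]_D) : Prop :=
  (forall o, psdmx (M o)) /\ \sum_(o < k) M o = 1%:M.

(* probability that measuring rho^{(x) n} with the POVM M and outputting
   the estimate est o (for outcome o) lands within eps of the value v *)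
Definition success_prob {d n k : nat} (M : 'I_k -> 'M[C]_(d ^ n))
  (est : 'I_k -> R) (rho : 'M[C]_d) (v eps : R) : R :=
  \sum_(o < k | `|est o - v| <= eps) complex.Re (\tr (M o *m (rho ^t n))).

End Quantum.

(* Main.v *)
(** The known state [sigma] is diagonal, with one coordinate of constant weight,
    one null coordinate, and [r - 1] coordinates of weight [b] of order [eps / r].

    For the [1 / eps ^ 2] bound, two pure states in the plane of the heavy and of
    the null coordinate have values that differ by more than [2 * eps], while
    their overlap is [sqrt (1 - 36 * eps ^ 2)]; no effect tells their [n]-th
    tensor powers apart unless [n * eps ^ 2] is bounded below.

    For the [r / eps] bound, [sigma] is compared with the states obtained by
    replacing a flat block [b * 1] by [b * (1 + Z s)], where
    [Z s = D_s [[0, F], [F^T, 0]] D_s], [F] is a normalised Hadamard matrix of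
    size [m] and [D_s] a diagonal matrix of random signs.  These states all have
    the same Tsallis relative entropy to [sigma], larger than [2 * eps].  The
    average of their [n]-th tensor powers has chi-square moment
    [E_{s,t} (1 + b * tr (Z s * Z t)) ^ n] relative to [sigma].  Since the entries
    of [F] have constant modulus, [tr (Z s * Z t)] is [2 / m] times the product of
    two sums of [m] random signs, so it has bounded exponential moments instead of
    fluctuations of order [sqrt m], and the chi-square moment stays close to [1]
    as long as [n * b] is small. *)
Require Import Defs.
From mathcomp Require Import all_boot all_order all_algebra.
From mathcomp Require Import reals sequences exp.
From mathcomp Require Import complex mxtens.
From mathcomp Require Import ring lra zify.
From Stdlib Require Import ClassicalEpsilon.
Import Order.TTheory GRing.Theory Num.Theory.

Set Implicit Arguments.
Unset Strict Implicit.
Unset Printing Implicit Defensive.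

Local Open Scope ring_scope.
Local Open Scope complex_scope.

(** * Linear algebra over the complex numbers *)

Section TensorPowers.
Variable R : comNzRingType.

Lemma ntensmx_mul m n p (A : 'M[R]_(m, n)) (B : 'M[R]_(n, p)) k :
  A ^t k *m B ^t k = (A *m B) ^t k.
Proof.
case: k => [|k]; first by rewrite /ntensmx mul1mx.
rewrite /ntensmx; elim: k => [//|k IHk] /=.
by rewrite -IHk -tensmx_mul.
Qed.

Lemma mxtrace_tens m n (A : 'M[R]_m) (B : 'M[R]_n) :
  \tr (A *t B) = \tr A * \tr B.
Proof. by rewrite /mxtrace mulr_sum; apply: eq_bigr => i _; rewrite mxE. Qed.

Lemma mxtrace_ntens m (A : 'M[R]_m) k : \tr (A ^t k) = \tr A ^+ k.
Proof.
case: k => [|k]; first by rewrite /ntensmx mxtrace1.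
rewrite /ntensmx; elim: k => [|k IHk] /=; first by rewrite expr1.
by rewrite exprS -IHk -mxtrace_tens.
Qed.

End TensorPowers.

Section Forms.
Variable K : comNzRingType.

Lemma form_delta2 n (B : 'M[K]_n) (a a' b b' : K) i j :
  ((a' *: delta_mx 0 i + b' *: delta_mx 0 j : 'rV_n) *m B
     *m (a *: delta_mx i 0 + b *: delta_mx j 0 : 'cV_n)) 0 0 =
  a' * a * B i i + a' * b * B i j + b' * a * B j i + b' * b * B j j.
Proof.
rewrite !mulmxDl !mulmxDr -!scalemxAl -!scalemxAr -!rowE -!colE !mxE.
by ring.
Qed.

Lemma mxtrace_form_sub n k (P : 'M[K]_n) (X Y : 'M[K]_(n, k)) (X' Y' : 'M[K]_(k, n)) t :
  \tr ((t *: X' - Y') *m P *m (t *: X - Y)) =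
  t * (t * \tr (X' *m P *m X)) - t * \tr (X' *m P *m Y)
    - (t * \tr (Y' *m P *m X) - \tr (Y' *m P *m Y)).
Proof.
rewrite !mulmxBl !mulmxBr -!scalemxAl -!scalemxAr !linearB /= !linearZ /=.
by ring.
Qed.

End Forms.

(** * Conjugate transposes and real parts of traces *)

Section Adjoint.
Variable R : realType.
Local Notation C := R[i].
Local Notation cmx := (map_mx (real_complex R)).
Local Notation Re := (@complex.Re R).

Lemma adjmxE m n (A : 'M[C]_(m, n)) i j : adjmx A i j = (A j i)^*.
Proof. by rewrite !mxE. Qed.

Lemma adjmxK m n (A : 'M[C]_(m, n)) : adjmx (adjmx A) = A.
Proof. by apply/matrixP => i j; rewrite !adjmxE conjcK. Qed.

Lemma adjmxM m n p (A : 'M[C]_(m, n)) (B : 'M[C]_(n, p)) :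
  adjmx (A *m B) = adjmx B *m adjmx A.
Proof. by rewrite /adjmx map_mxM trmx_mul. Qed.

Lemma adjmxD m n (A B : 'M[C]_(m, n)) : adjmx (A + B) = adjmx A + adjmx B.
Proof. by apply/matrixP => i j; rewrite !mxE rmorphD. Qed.

Lemma adjmxB m n (A B : 'M[C]_(m, n)) : adjmx (A - B) = adjmx A - adjmx B.
Proof. by apply/matrixP => i j; rewrite !mxE rmorphB. Qed.

Lemma adjmxZ m n (a : R) (A : 'M[C]_(m, n)) :
  adjmx (a%:C *: A) = a%:C *: adjmx A.
Proof.
by apply/matrixP => i j; rewrite !mxE rmorphM /= oppr0.
Qed.

Lemma adjmx_sum I (r : seq I) m n (A : I -> 'M[C]_(m, n)) :
  adjmx (\sum_(i <- r) A i) = \sum_(i <- r) adjmx (A i).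
Proof.
apply: (big_morph (@adjmx R m n)) => [A1 A2|]; first exact: adjmxD.
by apply/matrixP => i j; rewrite !mxE conjc0.
Qed.

Lemma adjmx1 n : adjmx 1%:M = 1%:M :> 'M[C]_n.
Proof. by apply/matrixP => i j; rewrite !mxE eq_sym rmorphMn /= oppr0. Qed.

Lemma adjmx_real m n (A : 'M[R]_(m, n)) : adjmx (cmx A) = cmx A^T.
Proof. by apply/matrixP => i j; rewrite !mxE conjc_real. Qed.

Lemma adjmx_block m n p q (A : 'M[C]_(m, n)) (B : 'M[C]_(p, q)) :
  adjmx (block_mx A 0 0 B) = block_mx (adjmx A) 0 0 (adjmx B).
Proof.
by rewrite /adjmx map_block_mx tr_block_mx !map_mx0 !trmx0.
Qed.

Lemma adjmx_tens m n p q (A : 'M[C]_(m, n)) (B : 'M[C]_(p, q)) :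
  adjmx (A *t B) = adjmx A *t adjmx B.
Proof. by rewrite /adjmx map_mxT trmx_tens. Qed.

Lemma adjmx_ntens m n (A : 'M[C]_(m, n)) k : adjmx (A ^t k) = adjmx A ^t k.
Proof.
case: k => [|k]; first exact: adjmx1.
rewrite /ntensmx; elim: k => [//|k IHk] /=.
by rewrite -IHk -adjmx_tens.
Qed.

Lemma ReD (x y : C) : Re (x + y) = Re x + Re y.
Proof. by case: x; case: y. Qed.

Lemma ReB (x y : C) : Re (x - y) = Re x - Re y.
Proof. by case: x; case: y. Qed.

Lemma Re_mxtrace_sum n I (r : seq I) (P : pred I) (F : I -> 'M[C]_n) :
  Re (\tr (\sum_(i <- r | P i) F i)) = \sum_(i <- r | P i) Re (\tr (F i)).
Proof.
apply: (big_morph (fun A : 'M[C]_n => Re (\tr A))) => [A B|].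
  by rewrite linearD /= ReD.
by rewrite linear0.
Qed.

Lemma Re_ge0 (x : C) : 0 <= x -> 0 <= Re x.
Proof. by rewrite lecE => /andP[]. Qed.

Lemma mxtrace_adj n (A : 'M[C]_n) : \tr (adjmx A) = (\tr A)^*.
Proof. by rewrite /mxtrace rmorph_sum; apply: eq_bigr => i _; rewrite adjmxE. Qed.

Lemma mxtrace_real n (A : 'M[R]_n) : \tr (cmx A) = (\tr A)%:C.
Proof. by rewrite /mxtrace rmorph_sum; apply: eq_bigr => i _; rewrite mxE. Qed.

End Adjoint.

(** * Positive semidefinite matrices and effects *)

Section Positivity.
Variable R : realType.
Local Notation C := R[i].
Local Notation Re := (@complex.Re R).

Lemma psdmx_trace_ge0 n k (P : 'M[C]_n) (X : 'M[C]_(n, k)) :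
  psdmx P -> 0 <= \tr (adjmx X *m P *m X).
Proof.
move=> psdP; apply: sumr_ge0 => j _; have := psdP (col j X).
congr (0 <= _); rewrite !mxE; apply: eq_bigr => i _; rewrite !mxE.
by congr (_ * _); apply: eq_bigr => l _; rewrite !mxE.
Qed.

Lemma psdmx_congr n k (P : 'M[C]_n) (X : 'M[C]_(n, k)) :
  psdmx P -> psdmx (adjmx X *m P *m X).
Proof. by move=> psdP v; have := psdP (X *m v); rewrite adjmxM !mulmxA. Qed.

Lemma psdmxD n (P Q : 'M[C]_n) : psdmx P -> psdmx Q -> psdmx (P + Q).
Proof.
by move=> pP pQ v; rewrite mulmxDr mulmxDl mxE addr_ge0 ?pP ?pQ.
Qed.

Lemma psdmx_sum n (I : finType) (A : pred I) (P : I -> 'M[C]_n) :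
  (forall i, psdmx (P i)) -> psdmx (\sum_(i | A i) P i).
Proof.
move=> pP; apply: (big_ind (@psdmx R n)) => [v|P1 P2|i _] //; last exact: psdmxD.
by rewrite mulmx0 mul0mx mxE.
Qed.

Lemma psdmx_gram n k (X : 'M[C]_(n, k)) : psdmx (X *m adjmx X).
Proof.
move=> v; rewrite -mulmxA -mulmxA mulmxA.
rewrite -[X in X *m _]adjmxK adjmxM adjmxK mxE sumr_ge0 // => i _.
by rewrite adjmxE mulrC mulcJ_ge0.
Qed.

Lemma psdmx1 n : @psdmx R n 1%:M.
Proof. by rewrite -[1%:M]mulmx1 -{2}(@adjmx1 R n); exact: psdmx_gram. Qed.

(** Polarisation: the form is real at [e_i], [e_j], [e_i + e_j] and [e_i + 'i e_j], which ties both
    parts of [P j i] to those of [P i j]. *)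
Lemma psdmx_adj n (P : 'M[C]_n) : psdmx P -> adjmx P = P.
Proof.
move=> psdP.
have real0 a b i j : complex.Im
    (a^* * a * P i i + a^* * b * P i j + b^* * a * P j i + b^* * b * P j j) = 0.
  rewrite -form_delta2; have := psdP (a *: delta_mx i 0 + b *: delta_mx j 0).
  have -> : adjmx (a *: delta_mx i 0 + b *: delta_mx j 0 : 'cV_n) =
      a^* *: delta_mx 0 i + b^* *: delta_mx 0 j.
    apply/matrixP => u v; rewrite !mxE rmorphD !rmorphM !rmorph_nat.
    by rewrite ![(v == _) && _]andbC.
  exact: ger0_Im.
apply/matrixP => i j; rewrite adjmxE.
have := real0 1 0 i j; have := real0 0 1 i j.
have := real0 1 1 i j; have := real0 1 'i i j.
case: (P i i) => a1 b1; case: (P i j) => a2 b2; case: (P j i) => a3 b3.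
case: (P j j) => a4 b4 /=.
by simpc; move=> h1 h2 h3 h4; congr (_ +i* _); lra.
Qed.

(** Positivity of the form at [t X - Y]. The free weight [t] replaces the square roots of the usual
    inequality; each use picks a suitable value. *)
Lemma mxtrace_cauchy_schwarz n k (P : 'M[C]_n) (X Y : 'M[C]_(n, k)) (t : R) :
  psdmx P ->
  2%:R * t * Re (\tr (adjmx X *m P *m Y)) <=
    t ^+ 2 * Re (\tr (adjmx X *m P *m X)) + Re (\tr (adjmx Y *m P *m Y)).
Proof.
move=> psdP.
have /Re_ge0 := psdmx_trace_ge0 (t%:C *: X - Y) psdP.
rewrite adjmxB adjmxZ mxtrace_form_sub.
have -> : \tr (adjmx Y *m P *m X) = (\tr (adjmx X *m P *m Y))^*.
  by rewrite -mxtrace_adj !adjmxM adjmxK psdmx_adj // mulmxA.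
move: (\tr _) (\tr _) (\tr _) => [u u'] [v v'] [w w'] /=; lra.
Qed.

(** [N] commutes with [1 - N], so the difference equals [N (1 - N) N + (1 - N) N (1 - N)], a sum of
    congruences of positive matrices. *)
Lemma psdmx_sub_sqr n (N : 'M[C]_n) :
  psdmx N -> psdmx (1%:M - N) -> psdmx (N - N *m N).
Proof.
move=> pN pN1.
have -> : N - N *m N = adjmx N *m (1%:M - N) *m N
   + adjmx (1%:M - N) *m N *m (1%:M - N).
  rewrite (psdmx_adj pN) (psdmx_adj pN1).
  have -> : (1%:M - N) *m N = N *m (1%:M - N).
    by rewrite mulmxBl mulmxBr mul1mx mulmx1.
  by rewrite -mulmxDr addrCA subrr addr0 mulmx1 mulmxBr mulmx1.
by apply: psdmxD; apply: psdmx_congr.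
Qed.

Lemma mxtrace_effect_sqr n (N T : 'M[C]_n) :
  psdmx N -> psdmx (1%:M - N) -> adjmx T = T ->
  Re (\tr (N *m T *m T *m N)) <= Re (\tr (N *m (T *m T))).
Proof.
move=> pN pN1 aT.
have /Re_ge0 := psdmx_trace_ge0 T (psdmx_sub_sqr pN pN1).
rewrite aT mulmxBr mulmxBl linearB /= ReB subr_ge0.
have -> : \tr (T *m N *m T) = \tr (N *m (T *m T)).
  by rewrite -mulmxA mxtrace_mulC mulmxA.
suff -> : \tr (T *m (N *m N) *m T) = \tr (N *m T *m T *m N) by [].
by rewrite [RHS]mxtrace_mulC [LHS]mxtrace_mulC !mulmxA mxtrace_mulC !mulmxA
  mxtrace_mulC !mulmxA.
Qed.

End Positivity.

(** * Matrix powers through spectral decompositions *)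

Section FunctionalCalculus.
Variable R : realType.
Local Notation C := R[i].
Local Notation cmx := (map_mx (real_complex R)).
Local Notation Re := (@complex.Re R).

(** [mxpowR] takes a decomposition picked by [epsilon]; any other gives the same power. The change
    of basis [W] intertwines the two spectra, so [W i j] is nonzero only between equal eigenvalues,
    and [W] also intertwines their powers. *)
Lemma mxpowR_spectral n (A U : 'M[C]_n) (l : 'I_n -> R) (p : R) :
  psd_spectral A (U, l) ->
  mxpowR A p = U *m diag_mx (\row_i (powR (l i) p)%:C) *m adjmx U.
Proof.
move=> specU; rewrite /mxpowR; set Vk := epsilon _ _.
have : psd_spectral A Vk by apply: epsilon_spec; exists (U, l).
case: Vk => V k [/= unV [_ AV]]; case: specU => [/= unU [_ AU]].
have unU' : U *m adjmx U = 1%:M by apply: mulmx1C.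
have unV' : V *m adjmx V = 1%:M by apply: mulmx1C.
pose W := adjmx V *m U.
have eqW : W *m diag_mx (\row_i (l i)%:C) = diag_mx (\row_i (k i)%:C) *m W.
  have : adjmx V *m A *m U = adjmx V *m A *m U by [].
  rewrite {1}AU AV !mulmxA unV mul1mx -[_ *m adjmx U *m U]mulmxA unU mulmx1.
  by rewrite -[_ *m adjmx V *m U]mulmxA.
have WE : W = adjmx V *m U by [].
move: W eqW WE => W eqW WE.
have eqWp : W *m diag_mx (\row_i (powR (l i) p)%:C)
    = diag_mx (\row_i (powR (k i) p)%:C) *m W.
  apply/matrixP => i j; have /matrixP/(_ i j) := eqW.
  rewrite !mul_mx_diag !mul_diag_mx !mxE mulrC.
  have [->|W0] := eqVneq (W i j) 0; first by rewrite !mulr0 mul0r.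
  by move=> /(mulIf W0)/complexI ->; rewrite mulrC.
have UE : U = V *m W by rewrite WE mulmxA unV' mul1mx.
have -> : adjmx V = W *m adjmx U by rewrite WE -mulmxA unU' mulmx1.
transitivity (V *m W *m diag_mx (\row_i (powR (l i) p)%:C) *m adjmx U).
  by rewrite -[V *m W *m _]mulmxA eqWp !mulmxA.
by rewrite -UE.
Qed.

Lemma psd_spectral_diag n (l : 'rV[R]_n) :
  (forall i, 0 <= l 0 i) -> psd_spectral (cmx (diag_mx l)) (1%:M, l 0).
Proof.
move=> l_ge0; split=> /=; first by rewrite /Defs.unitarymx adjmx1 mulmx1.
split=> //; rewrite adjmx1 mul1mx mulmx1 map_diag_mx; congr diag_mx.
by apply/rowP => i; rewrite !mxE.
Qed.

Lemma mxpowR_diag n (l : 'rV[R]_n) p : (forall i, 0 <= l 0 i) ->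
  mxpowR (cmx (diag_mx l)) p = cmx (diag_mx (map_mx (fun x => powR x p) l)).
Proof.
move=> /psd_spectral_diag/mxpowR_spectral ->.
rewrite adjmx1 mul1mx mulmx1 map_diag_mx; congr diag_mx.
by apply/rowP => i; rewrite !mxE.
Qed.

Lemma mxpowR_block m n (A : 'M[C]_m) (B : 'M[C]_n) p :
  (exists Ul, psd_spectral A Ul) -> (exists Ul, psd_spectral B Ul) ->
  mxpowR (block_mx A 0 0 B) p = block_mx (mxpowR A p) 0 0 (mxpowR B p).
Proof.
case=> [[U l] specA] [[V k] specB].
pose lk i := match split i with inl j => l j | inr j => k j end.
have rowE (f : R -> C) : \row_i f (lk i) = row_mx (\row_i f (l i)) (\row_i f (k i)).
  by apply/rowP => i; rewrite !mxE /lk; case: split => j; rewrite mxE.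
have specAB : psd_spectral (block_mx A 0 0 B) (block_mx U 0 0 V, lk).
  case: specA => /= unU [l0 AE]; case: specB => /= unV [k0 BE].
  split=> /=.
    rewrite /Defs.unitarymx adjmx_block mulmx_block !mulmx0 !mul0mx !addr0 !add0r.
    by rewrite unU unV -scalar_mx_block.
  split; first by move=> i; rewrite /lk; case: split.
  rewrite (rowE (fun x => x%:C)) diag_mx_row adjmx_block !mulmx_block.
  by rewrite !(mulmx0, mul0mx, addr0, add0r) AE BE.
rewrite (mxpowR_spectral p specAB) (mxpowR_spectral p specA).
rewrite (mxpowR_spectral p specB) (rowE (fun x => (powR x p)%:C)).
by rewrite diag_mx_row adjmx_block !mulmx_block !(mulmx0, mul0mx, addr0, add0r).
Qed.

(** [A] is Hermitian, hence normal and unitarily diagonalisable; [A A = c A] forces every eigenvalue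
    to satisfy [x ^ 2 = c x]. *)
Lemma psd_spectral_scaled_proj n (A : 'M[C]_n) (c : R) :
  adjmx A = A -> A *m A = c%:C *: A -> 0 <= c ->
  exists Ul, psd_spectral A Ul /\ forall i, Ul.2 i = 0 \/ Ul.2 i = c.
Proof.
move=> aA AA c_ge0.
have : A \is @spectral.normalmx _ _.
  apply/spectral.normalmxP.
  have -> : map_mx Num.conj (A^T) = adjmx A by rewrite /adjmx map_trmx.
  by rewrite aA.
move=> /spectral.orthomx_spectral_subproof[[V l] /= unV AE].
have Vunit := spectral.unitarymx_unit unV.
have aV : adjmx V = invmx V.
  by rewrite spectral.invmx_unitary // /adjmx map_trmx.
have l0c i : l 0 i = 0 \/ l 0 i = c%:C.
  have : diag_mx l *m diag_mx l = c%:C *: diag_mx l.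
    have -> : diag_mx l = V *m A *m invmx V.
      by rewrite AE !mulmxA mulmxV // mul1mx mulmxK.
    by rewrite !mulmxA mulmxKV // -(mulmxA V A A) AA -scalemxAr -scalemxAl.
  move=> /matrixP/(_ i i); rewrite mul_diag_mx !mxE eqxx mulr1n => /eqP.
  by rewrite -subr_eq0 -mulrBl mulf_eq0 subr_eq0 => /orP[] /eqP; [right|left].
pose k i := Re (l 0 i).
have lE : l = \row_i (k i)%:C.
  by apply/rowP => i; rewrite mxE /k; case: (l0c i) => ->.
exists (adjmx V, k); split=> /=; last first.
  by move=> i; rewrite /k; case: (l0c i) => ->; [left|right].
split=> /=; first by rewrite /Defs.unitarymx adjmxK aV mulmxV.
split; first by move=> i; rewrite /k; case: (l0c i) => ->.
by rewrite -lE adjmxK aV.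
Qed.

(** On the only possible eigenvalues [0] and [c], the function [x ^ p] agrees with the linear
    function [(c ^ p / c) x]. *)
Lemma mxpowR_scaled_proj n (A : 'M[C]_n) (c p : R) :
  adjmx A = A -> A *m A = c%:C *: A -> 0 <= c -> p != 0 ->
  mxpowR A p = (powR c p / c)%:C *: A.
Proof.
move=> aA AA c_ge0 p0.
have [[U l] [specA l0c]] := psd_spectral_scaled_proj aA AA c_ge0.
rewrite (mxpowR_spectral p specA); case: specA => /= _ [_ ->].
rewrite scalemxAl scalemxAr; congr (_ *m _ *m _).
apply/matrixP => i j; rewrite !mxE mulrnAr; congr (_ *+ _).
rewrite -rmorphM /=; congr (_ %:C).
case: (l0c i) => /= ->; first by rewrite powR0 // mulr0.
have [->|c0] := eqVneq c 0; first by rewrite powR0 // mulr0.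
by rewrite divfK.
Qed.

Lemma tsallisD_self n (l : 'rV[R]_n) (alpha : R) :
  0 < alpha < 1 -> (forall i, 0 <= l 0 i) -> \sum_i l 0 i = 1 ->
  tsallisD alpha (cmx (diag_mx l)) (cmx (diag_mx l)) = 0.
Proof.
move=> /andP[a0 a1] l_ge0 l1; rewrite /tsallisD !mxpowR_diag // -map_mxM.
rewrite mxtrace_real /= mulmx_diag mxtrace_diag.
under eq_bigr => i _.
  have -> : (\row_j (map_mx (fun x => powR x alpha) l 0 j *
     map_mx (fun x => powR x (1 - alpha)) l 0 j)) 0 i = l 0 i.
    rewrite !mxE; have := l_ge0 i; rewrite le_eqVlt => /orP[/eqP <-|li0].
      by rewrite powR0 ?mul0r // gt_eqF.
    by rewrite -powRD ?(gt_eqF li0) ?implybT // subrKC powRr1 // ltW.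
  over.
by rewrite l1 subrr mul0r.
Qed.

End FunctionalCalculus.

(** * Distinguishing states by effects *)

Section Measurements.
Variable R : realType.
Local Notation C := R[i].
Local Notation Re := (@complex.Re R).

(* An estimator separating two values yields an effect [N], namely "the
   estimate is close to [v2]", distinguishing the corresponding states. *)
Lemma estimator_effect d n k (M : 'I_k -> 'M[C]_(d ^ n)) (est : 'I_k -> R)
    (v1 v2 eps : R) :
  povm M -> eps + eps < `|v1 - v2| ->
  exists N : 'M[C]_(d ^ n),
    [/\ psdmx N, psdmx (1%:M - N),
        forall rho, success_prob M est rho v2 eps = Re (\tr (N *m (rho ^t n))) &
        forall j (X : 'M[C]_(d, j)), \tr (X *m adjmx X) = 1 ->
          Re (\tr (N *m ((X *m adjmx X) ^t n))) <=
            1 - success_prob M est (X *m adjmx X) v1 eps].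
Proof.
move=> [psdM sumM] v12.
pose close v := [pred o : 'I_k | `|est o - v| <= eps].
exists (\sum_(o | close v2 o) M o).
have compl : 1%:M - \sum_(o | close v2 o) M o = \sum_(o | ~~ close v2 o) M o.
  by rewrite -sumM (bigID (close v2)) /= addrAC subrr add0r.
have sumE (P : pred 'I_k) (A : 'M[C]_(d ^ n)) :
    Re (\tr ((\sum_(o | P o) M o) *m A)) = \sum_(o | P o) Re (\tr (M o *m A)).
  by rewrite mulmx_suml Re_mxtrace_sum.
split; first exact: psdmx_sum.
- by rewrite compl; apply: psdmx_sum.
- by move=> rho; rewrite sumE.
move=> j X tr1; set A := _ ^t n.
have M_ge0 o : 0 <= Re (\tr (M o *m A)).
  rewrite /A -ntensmx_mul -adjmx_ntens mulmxA mxtrace_mulC mulmxA.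
  exact/Re_ge0/psdmx_trace_ge0.
rewrite lerBrDl /success_prob sumE.
have <- : \sum_o Re (\tr (M o *m A)) = 1.
  by rewrite -sumE sumM mul1mx mxtrace_ntens tr1 expr1n.
rewrite [leRHS](bigID (close v1)) /= lerD2l.
rewrite [leRHS](bigID (close v2)) /= ler_wpDr ?sumr_ge0 //.
rewrite [leRHS](eq_bigl (close v2)) // => o /=.
(* An outcome close to both values would bring [v1] and [v2] within [2 eps]. *)
case: (leP `|est o - v2| eps) => [h2|]; last by rewrite andbF.
rewrite andbT -ltNge; apply: contraTT v12; rewrite -!leNgt => h1.
have -> : v1 - v2 = (est o - v2) - (est o - v1) by ring.
by rewrite (le_trans (ler_normB _ _)) // lerD.
Qed.

(** Cauchy-Schwarz is applied to [N] and to [1 - N], and the bounds are added. The weights [3/2] and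
    [2/3] are rational stand-ins for the optimal [sqrt 2] and [1 / sqrt 2], which would give
    [2 sqrt 2 / 3]. *)
Lemma fidelity_bound n k (N : 'M[C]_n) (X Y : 'M[C]_(n, k)) :
  psdmx N -> psdmx (1%:M - N) ->
  Re (\tr (adjmx X *m X)) = 1 -> Re (\tr (adjmx Y *m Y)) = 1 ->
  Re (\tr (adjmx X *m N *m X)) <= 1 / 3%:R ->
  2%:R / 3%:R <= Re (\tr (adjmx Y *m N *m Y)) ->
  Re (\tr (adjmx X *m Y)) <= 17%:R / 18%:R.
Proof.
move=> pN pN1 X1 Y1 Xp Yq.
have := mxtrace_cauchy_schwarz X Y (3%:R / 2%:R) pN.
have := mxtrace_cauchy_schwarz X Y (2%:R / 3%:R) pN1.
have E (A B : 'M[C]_(n, k)) : \tr (adjmx A *m (1%:M - N) *m B) =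
    \tr (adjmx A *m B) - \tr (adjmx A *m N *m B).
  by rewrite mulmxBr mulmxBl mulmx1 linearB.
rewrite !E !ReB X1 Y1; move: Xp Yq.
move: (\tr _) (\tr _) (\tr _) (\tr _) => [u u'] [v v'] [w w'] [x x'] /=; lra.
Qed.

(* [S] plays the role of the pseudo-inverse of [T], a square root of the null
   state [T *m T]; the conclusion bounds a chi-square divergence from below. *)
Lemma chi_square_bound n (I : Type) (s : seq I) (Q : I -> 'M[C]_n)
    (N T S : 'M[C]_n) :
  (0 < size s)%N ->
  psdmx N -> psdmx (1%:M - N) -> adjmx T = T -> adjmx S = S ->
  (forall i, adjmx (Q i) = Q i) -> (forall i, T *m S *m Q i = Q i) ->
  Re (\tr (N *m (T *m T))) <= 1 / 3%:R ->
  (forall i, 2%:R / 3%:R <= Re (\tr (N *m Q i))) ->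
  4%:R / 3%:R * (size s)%:R ^+ 2 <=
    \sum_(i <- s) \sum_(j <- s) Re (\tr (Q i *m (S *m S) *m Q j)).
Proof.
move=> s_gt0 pN pN1 aT aS aQ TSQ Np Nq.
set K := (size s)%:R; have K_gt0 : 0 < K :> R by rewrite ltr0n.
pose QQ := \sum_(i <- s) Q i.
(* The weight [2 K] is optimal: it leaves [4 K (2 K / 3) - 4 K ^ 2 / 3 = 4 K ^ 2 / 3]. *)
have := mxtrace_cauchy_schwarz (T *m N) (S *m QQ) (2%:R * K) (@psdmx1 R n).
rewrite !mulmx1 !adjmxM aT aS (psdmx_adj pN).
have -> : N *m T *m (S *m QQ) = N *m QQ.
  rewrite -mulmxA (mulmxA T); congr (N *m _).
  by rewrite /QQ mulmx_sumr; apply: eq_bigr => i _; rewrite TSQ.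
have -> : Re (\tr (adjmx QQ *m S *m (S *m QQ))) =
    \sum_(i <- s) \sum_(j <- s) Re (\tr (Q i *m (S *m S) *m Q j)).
  rewrite !mulmxA -(mulmxA _ S S) /QQ adjmx_sum !mulmx_suml Re_mxtrace_sum.
  apply: eq_bigr => i _; rewrite aQ mulmx_sumr Re_mxtrace_sum.
  by apply: eq_bigr => j _; rewrite -?mulmxA.
have sumN : 2%:R / 3%:R * K <= Re (\tr (N *m QQ)).
  rewrite mulmx_sumr Re_mxtrace_sum mulr_natr /K.
  have -> : (2%:R / 3%:R) *+ size s = \sum_(i <- s) (2%:R / 3%:R) :> R.
    by rewrite big_const_seq count_predT iter_addr_0.
  exact: ler_sum.
have := mxtrace_effect_sqr pN pN1 aT.
rewrite !mulmxA => h1 h2; rewrite mulmxA in Np.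
have h3 := le_trans h1 Np.
nra.
Qed.

End Measurements.

(** * Exponential moments and Hadamard matrices *)

Section SignSums.
Variable R : realType.

(** For [|y| > 1/2], [|y| <= 2 y ^ 2] bounds each term; otherwise [exp z <= 1 / (1 - z)] bounds the
    sum by [2 / (1 - y ^ 2)]. *)
Lemma expR_cosh_le (y : R) : expR y + expR (- y) <= 2%:R * expR (2%:R * y ^+ 2).
Proof.
have [y_small|y_big] := leP (4%:R * y ^+ 2) 1; last first.
  have : expR y <= expR (2%:R * y ^+ 2) by rewrite ler_expR; nra.
  have : expR (- y) <= expR (2%:R * y ^+ 2) by rewrite ler_expR; nra.
  lra.
have inv_bound (z : R) : z < 1 -> expR z <= (1 - z)^-1.
  move=> z1; rewrite -[z in expR z]opprK expRN lef_pV2 ?posrE ?expR_gt0 ?subr_gt0 //.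
  exact: expR_ge1Dx.
have y1 : y < 1 by nra.
have Ny1 : - y < 1 by nra.
have h1 := inv_bound _ y1; have h2 := inv_bound _ Ny1; rewrite opprK in h2.
have h3 := expR_ge1Dx (2%:R * y ^+ 2).
have h4 : (1 - y)^-1 + (1 + y)^-1 <= 2%:R * (1 + 2%:R * y ^+ 2).
  have -> : (1 - y)^-1 + (1 + y)^-1 = 2%:R / (1 - y ^+ 2).
    have ? : 1 - y != 0 by apply/eqP; lra.
    have ? : 1 + y != 0 by apply/eqP; lra.
    have ? : 1 - y ^+ 2 != 0 by apply/eqP; nra.
    by field; apply/and3P.
  rewrite ler_pdivrMr; nra.
lra.
Qed.

Fixpoint bitseqs k : seq bitseq :=
  if k is k'.+1 then map (cons false) (bitseqs k') ++ map (cons true) (bitseqs k')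
  else [:: [::]].

Lemma size_bitseqs k : size (bitseqs k) = (2 ^ k)%N.
Proof. by elim: k => //= k IHk; rewrite size_cat !size_map IHk addnn -mul2n expnS. Qed.

Definition sgn (s : bitseq) (i : nat) : R := (-1) ^+ nth false s i.

Lemma sqr_sgn s i : sgn s i ^+ 2 = 1.
Proof. exact: sqrr_sign. Qed.

Lemma normr_sgn s i : `|sgn s i| = 1.
Proof. exact: normr_sign. Qed.

(** Sub-Gaussian moment of a shifted sum of random signs, by induction on [k]. Removing the first
    sign moves the shift from [x] to [x + w 0] or [x - w 0]; [expR_cosh_le] recombines the two at
    the price of a larger coefficient of [x ^ 2]. *)
Lemma sum_expR_sqr_le k (a x : R) (w : nat -> R) :
  0 <= a -> 32%:R * a * k%:R <= 1 -> (forall i, w i ^+ 2 = 1) ->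
  \sum_(s <- bitseqs k) expR (a * (x + \sum_(i < k) sgn s i * w i) ^+ 2) <=
    2%:R ^+ k * expR ((a + 32%:R * a ^+ 2 * k%:R) * x ^+ 2 + 2%:R * a * k%:R).
Proof.
elim: k x w => [|k IHk] x w a_ge0 ak w1.
  by rewrite big_seq1 big_ord0 !mulr0 !addr0 mul1r.
have ak' : 32%:R * a * k%:R <= 1.
  by apply: le_trans ak; rewrite ler_wpM2l ?mulr_ge0 // ler_nat.
rewrite /= big_cat !big_map /=.
have stepE (c : bool) : \sum_(s <- bitseqs k)
      expR (a * (x + \sum_(i < k.+1) sgn (c :: s) i * w i) ^+ 2) =
    \sum_(s <- bitseqs k)
      expR (a * (x + (-1) ^+ c * w 0%N + \sum_(i < k) sgn s i * w i.+1) ^+ 2).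
  by apply: eq_bigr => s _; rewrite big_ord_recl addrA.
rewrite (stepE false) (stepE true) expr0 expr1 mul1r mulN1r.
have IH y := IHk y (fun i => w i.+1) a_ge0 ak' (fun i => w1 i.+1).
apply: le_trans (lerD (IH _) (IH _)) _.
rewrite -mulrDr (exprSr _ k) -[X in _ <= X]mulrA ler_wpM2l ?exprn_ge0 //.
set B := a + 32%:R * a ^+ 2 * k%:R; rewrite -/B in IH *.
have expand (v : R) : v ^+ 2 = 1 -> B * (x + v) ^+ 2 + 2%:R * a * k%:R =
    (B * x ^+ 2 + B + 2%:R * a * k%:R) + 2%:R * B * x * v.
  by move=> v1; rewrite sqrrD v1; ring.
rewrite !expand ?sqrrN // mulrN !expRD -mulrDr.
have := expR_cosh_le (2%:R * B * x * w 0%N).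
set E := expR (B * x ^+ 2) * _ * _ => /(ler_wpM2l (x := E)) cosh_le.
apply: le_trans (cosh_le _) _; first by rewrite !mulr_ge0 ?expR_ge0.
rewrite mulrCA ler_wpM2l // /E -!expRD ler_expR.
have -> : (2%:R * B * x * w 0%N) ^+ 2 = 4%:R * B ^+ 2 * x ^+ 2.
  by rewrite !exprMn w1; ring.
have k_ge0 : 0 <= k%:R :> R by [].
have B_ge0 : 0 <= B by rewrite /B addr_ge0 ?mulr_ge0 ?exprn_ge0.
(* The hypothesis [32 a k <= 1] gives [B <= 2 a]. The cost [8 B ^ 2 x ^ 2] of the recombination is
   then at most [32 a ^ 2 x ^ 2], and the stray [B] fits into the additional [2 a]. *)
have B_le : B <= 2%:R * a by rewrite /B; nra.
have B2 : B ^+ 2 <= 4%:R * a ^+ 2 by nra.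
have := ler_wpM2r (sqr_ge0 x) B2; rewrite -natr1.
move: (sqr_ge0 x); rewrite /B; nra.
Qed.

End SignSums.

(** * Hadamard matrices of size a power of two *)

Section Hadamard.
Variable R : realType.

(** Sylvester's doubling. The size is a variable [m] with an equation because the doubled block
    matrix has size [m + m]. *)
Lemma sylvester_hadamard k : exists m (H : 'M[R]_m),
  [/\ m = (2 ^ k)%N, forall i j, H i j ^+ 2 = 1 & H *m H^T = m%:R%:M].
Proof.
elim: k => [|k [m [H [mE H1 HH]]]].
  by exists 1%N, 1%:M; split=> // [i j|]; rewrite ?(ord1 i) ?(ord1 j) ?mxE ?expr1n // trmx1 mulmx1.
exists (m + m)%N, (block_mx H H H (- H)); split.
- by rewrite mE addnn -mul2n expnS.
- move=> i j; rewrite -(splitK i) -(splitK j).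
  case: (split i) => i'; case: (split j) => j' /=;
  by rewrite ?(block_mxEul, block_mxEur, block_mxEdl, block_mxEdr) ?mxE ?sqrrN H1.
rewrite tr_block_mx mulmx_block !linearN /= !(mulNmx, mulmxN) opprK HH subrr.
by rewrite -raddfD /= -natrD -scalar_mx_block.
Qed.

Lemma flat_orthogonal k : exists F : 'M[R]_(2 ^ k),
  [/\ forall i j, F i j ^+ 2 = (2 ^ k)%:R^-1, F *m F^T = 1%:M & F^T *m F = 1%:M].
Proof.
have [m [H [mE H1 HH]]] := sylvester_hadamard k.
have m_gt0 : 0 < m%:R :> R by rewrite ltr0n mE expn_gt0.
pose F := (Num.sqrt m%:R)^-1 *: H.
have sqrt2 : (Num.sqrt m%:R)^-1 ^+ 2 = m%:R^-1 :> R.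
  by rewrite exprVn sqr_sqrtr // ltW.
have FF : F *m F^T = 1%:M.
  rewrite /F linearZ /= -scalemxAl -scalemxAr scalerA -expr2 sqrt2 HH.
  by rewrite scale_scalar_mx mulVf // gt_eqF.
rewrite -mE; exists F; split=> // [i j|]; last exact: mulmx1C.
by rewrite mxE exprMn H1 mulr1 sqrt2.
Qed.

End Hadamard.

(** * The hard family of states *)

Section HardFamily.
Variable R : realType.
Local Notation cmx := (map_mx (real_complex R)).

Lemma map_block_diag m n (A : 'M[R]_m) (B : 'M[R]_n) :
  cmx (block_mx A 0 0 B) = block_mx (cmx A) 0 0 (cmx B).
Proof. by rewrite map_block_mx !map_mx0. Qed.

(** For orthogonal [F] this is a symmetric traceless involution [Z], so [1 + Z] is twice a
    projection of half rank. *)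
Definition reflection m (F : 'M[R]_m) : 'M[R]_(m + m) := block_mx 0 F F^T 0.

Lemma reflection_tr m (F : 'M[R]_m) : (reflection F)^T = reflection F.
Proof. by rewrite /reflection tr_block_mx trmxK !trmx0. Qed.

Lemma reflectionK m (F : 'M[R]_m) : F *m F^T = 1%:M -> F^T *m F = 1%:M ->
  reflection F *m reflection F = 1%:M.
Proof.
move=> FF FF'; rewrite /reflection mulmx_block !(mulmx0, mul0mx, addr0, add0r).
by rewrite FF FF' -scalar_mx_block.
Qed.

Lemma reflection_trace m (F : 'M[R]_m) : \tr (reflection F) = 0.
Proof. by rewrite mxtrace_block !mxtrace0 addr0. Qed.

Definition signmx n (s : bitseq) : 'M[R]_n := diag_mx (\row_i sgn R s i).

Lemma signmxK n s : signmx n s *m signmx n s = 1%:M.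
Proof.
rewrite mulmx_diag -diag_const_mx; congr diag_mx.
by apply/rowP => i; rewrite !mxE -expr2 sqr_sgn.
Qed.

Definition sign_conj n s (A : 'M[R]_n) := signmx n s *m A *m signmx n s.

Lemma sign_conj_tr n s (A : 'M[R]_n) : (sign_conj s A)^T = sign_conj s A^T.
Proof. by rewrite /sign_conj !trmx_mul !tr_diag_mx mulmxA. Qed.

Lemma sign_conjK n s (A : 'M[R]_n) :
  A *m A = 1%:M -> sign_conj s A *m sign_conj s A = 1%:M.
Proof.
move=> AA; rewrite /sign_conj !mulmxA -(mulmxA _ (signmx n s) (signmx n s)).
by rewrite signmxK mulmx1 -(mulmxA _ A A) AA mulmx1 signmxK.
Qed.

Lemma sign_conj_trace n s (A : 'M[R]_n) : \tr (sign_conj s A) = \tr A.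
Proof. by rewrite /sign_conj mxtrace_mulC mulmxA signmxK mul1mx. Qed.

Lemma sign_conjE n s (A : 'M[R]_n) i j :
  sign_conj s A i j = sgn R s i * A i j * sgn R s j.
Proof. by rewrite /sign_conj mul_mx_diag mul_diag_mx !mxE. Qed.

(* All entries of [F] having the same modulus makes the overlap factor through
   the two partial sums of the signs [s i * t i]. *)
Lemma sign_conj_overlap m (F : 'M[R]_m) s t :
  (forall i j, F i j ^+ 2 = m%:R^-1) ->
  \tr (sign_conj s (reflection F) *m sign_conj t (reflection F)) =
    2%:R / m%:R * (\sum_(i < m) sgn R s i * sgn R t i)
      * (\sum_(i < m) sgn R s (m + i) * sgn R t (m + i)).
Proof.
move=> F2; pose u i := sgn R s i * sgn R t i.
have trE : \tr (sign_conj s (reflection F) *m sign_conj t (reflection F)) =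
    \sum_(i < m + m) \sum_(j < m + m) u i * u j * reflection F i j ^+ 2.
  rewrite /mxtrace; apply: eq_bigr => i _; rewrite mxE.
  apply: eq_bigr => j _; rewrite !sign_conjE.
  have -> : reflection F j i = reflection F i j by rewrite -[in LHS]reflection_tr mxE.
  by rewrite /u; ring.
have half (f h : 'I_m -> R) :
    \sum_i \sum_j f i * h j * m%:R^-1 = m%:R^-1 * (\sum_i f i) * (\sum_j h j).
  rewrite -mulrA mulr_suml mulr_sumr; apply: eq_bigr => i _.
  by rewrite !mulr_sumr; apply: eq_bigr => j _; ring.
(* The diagonal blocks vanish; each off-diagonal block contributes [1 / m] times the product of the
   two half sums. *)
rewrite trE big_split_ord /=.
under eq_bigr => i _.
  rewrite big_split_ord /= big1 => [|j _]; last first.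
    by rewrite /reflection block_mxEul mxE expr0n mulr0.
  under eq_bigr => j _ do rewrite /reflection block_mxEur F2.
  rewrite add0r; over.
under [X in _ + X]eq_bigr => i _.
  rewrite big_split_ord /= [X in _ + X]big1 => [|j _]; last first.
    by rewrite /reflection block_mxEdr mxE expr0n mulr0.
  under eq_bigr => j _ do rewrite /reflection block_mxEdl mxE F2.
  rewrite addr0; over.
by rewrite /= !half; ring.
Qed.

(** [Z = 0] gives the known state; a symmetric traceless involution [Z] moves the weight of the flat
    block onto half of its dimensions, with eigenvalue [2 b]. *)
Definition tilted n p (b : R) (g : 'rV[R]_p) (Z : 'M[R]_n) : 'M[R]_(n + p) :=
  block_mx (b *: (1%:M + Z)) 0 0 (diag_mx g).

Definition flat_row n p (b : R) (g : 'rV[R]_p) : 'rV[R]_(n + p) :=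
  row_mx (const_mx b) g.

Lemma diag_flat_row n p b (g : 'rV[R]_p) :
  diag_mx (flat_row n b g) = tilted b g (0 : 'M[R]_n).
Proof.
by rewrite /flat_row diag_mx_row diag_const_mx /tilted addr0 scale_scalar_mx mulr1.
Qed.

Lemma involution_sqr n (Z : 'M[R]_n) : Z *m Z = 1%:M ->
  (1%:M + Z) *m (1%:M + Z) = 2%:R *: (1%:M + Z).
Proof.
move=> ZZ; rewrite mulmxDl !mulmxDr !mul1mx mulmx1 ZZ [Z + _]addrC.
by rewrite scaler_nat mulr2n.
Qed.

Lemma trace_tilted n p b (g : 'rV[R]_p) (Z : 'M[R]_n) : \tr Z = 0 ->
  \tr (tilted b g Z) = b * n%:R + \sum_i g 0 i.
Proof.
move=> Z0; rewrite mxtrace_block mxtrace_diag linearZ /= linearD /= Z0.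
by rewrite mxtrace1 addr0.
Qed.

Lemma density_tilted n p b (g : 'rV[R]_p) (Z : 'M[R]_n) :
  Z^T = Z -> Z *m Z = 1%:M -> \tr Z = 0 ->
  0 <= b -> (forall i, 0 <= g 0 i) -> b * n%:R + \sum_i g 0 i = 1 ->
  density (cmx (tilted b g Z)).
Proof.
move=> Zt ZZ Z0 b_ge0 g_ge0 sum1; split; last first.
  by rewrite mxtrace_real trace_tilted // sum1.
(* A Gram factor: [(1 + Z) ^ 2 = 2 (1 + Z)] explains the scale [sqrt (b / 2)]. *)
pose X := block_mx (Num.sqrt (b / 2%:R) *: (1%:M + Z)) 0 0
  (diag_mx (map_mx Num.sqrt g)).
have -> : tilted b g Z = X *m X^T.
  rewrite /X tr_block_mx !trmx0 mulmx_block !(mulmx0, mul0mx, addr0, add0r).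
  rewrite tr_diag_mx linearZ /= -scalemxAl -scalemxAr scalerA linearD /= trmx1 Zt.
  rewrite involution_sqr // scalerA -expr2 sqr_sqrtr ?divr_ge0 // divfK ?pnatr_eq0 //.
  rewrite mulmx_diag; congr (block_mx _ _ _ (diag_mx _)).
  by apply/rowP => i; rewrite !mxE -expr2 sqr_sqrtr.
by rewrite map_mxM -adjmx_real; exact: psdmx_gram.
Qed.

Lemma density_diag n (l : 'rV[R]_n) :
  (forall i, 0 <= l 0 i) -> \sum_i l 0 i = 1 -> density (cmx (diag_mx l)).
Proof.
move=> l_ge0 l1; split; last by rewrite mxtrace_real mxtrace_diag l1.
have -> : diag_mx l = diag_mx (map_mx Num.sqrt l) *m (diag_mx (map_mx Num.sqrt l))^T.
  rewrite tr_diag_mx mulmx_diag; congr diag_mx.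
  by apply/rowP => i; rewrite !mxE -expr2 sqr_sqrtr.
by rewrite map_mxM -adjmx_real; exact: psdmx_gram.
Qed.

Lemma flat_row_ge0 n p b (g : 'rV[R]_p) : 0 <= b -> (forall i, 0 <= g 0 i) ->
  forall i, 0 <= flat_row n b g 0 i.
Proof.
move=> b_ge0 g_ge0 i; rewrite /flat_row -(splitK i).
by case: (split i) => j /=; rewrite ?row_mxEl ?row_mxEr ?mxE.
Qed.

Lemma sum_flat_row n p b (g : 'rV[R]_p) :
  \sum_i flat_row n b g 0 i = b * n%:R + \sum_i g 0 i.
Proof. by rewrite -mxtrace_diag diag_flat_row trace_tilted // mxtrace0. Qed.

(** The tilted block has eigenvalues in [0] and [2 b], so its power is itself times
    [(2 b) ^ alpha / (2 b)]; as [Z] is traceless, the value does not depend on [Z]. *)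
Lemma tsallisD_tilted n p (alpha b : R) (g : 'rV[R]_p) (Z : 'M[R]_n) :
  0 < alpha < 1 -> Z^T = Z -> Z *m Z = 1%:M -> \tr Z = 0 ->
  0 < b -> (forall i, 0 <= g 0 i) -> b * n%:R + \sum_i g 0 i = 1 ->
  tsallisD alpha (cmx (tilted b g Z)) (cmx (diag_mx (flat_row n b g))) =
    b * n%:R * (1 - powR 2%:R alpha / 2%:R) / (1 - alpha).
Proof.
move=> /andP[a0 a1] Zt ZZ Z0 b_gt0 g_ge0 sum1; rewrite /tsallisD; congr (_ / _).
have b_ge0 := ltW b_gt0.
rewrite mxpowR_diag; last exact: flat_row_ge0.
pose P := b *: (1%:M + Z).
have aP : adjmx (cmx P) = cmx P.
  by rewrite adjmx_real /P linearZ /= linearD /= trmx1 Zt.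
have PP : cmx P *m cmx P = (2%:R * b)%:C *: cmx P.
  rewrite -map_mxM -map_mxZ; congr (map_mx _ _).
  rewrite /P -scalemxAl -scalemxAr involution_sqr // !scalerA; congr (_ *: _).
  by ring.
have b2_ge0 : 0 <= 2%:R * b by rewrite mulr_ge0.
rewrite {1}/tilted map_block_diag mxpowR_block; last 2 first.
- by have [Ul [specP _]] := psd_spectral_scaled_proj aP PP b2_ge0; exists Ul.
- by eexists; exact: psd_spectral_diag.
rewrite (mxpowR_scaled_proj aP PP) ?gt_eqF // mxpowR_diag // -map_mxZ.
have -> : map_mx (fun x => powR x (1 - alpha)) (flat_row n b g) =
    flat_row n (powR b (1 - alpha)) (map_mx (fun x => powR x (1 - alpha)) g).
  by rewrite /flat_row map_row_mx map_const_mx.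
rewrite diag_flat_row -map_block_diag -map_mxM mxtrace_real /=.
rewrite /tilted mulmx_block !(mulmx0, mul0mx, addr0, add0r) mxtrace_block.
rewrite -!scalemxAl -scalemxAr mulmx1 !linearZ /= linearD /= mxtrace1 Z0 addr0.
rewrite mulmx_diag mxtrace_diag.
have -> : \sum_j (\row_j0 (map_mx (fun x => powR x alpha) g 0 j0 *
     map_mx (fun x => powR x (1 - alpha)) g 0 j0)) 0 j = \sum_j g 0 j.
  apply: eq_bigr => j _; rewrite !mxE.
  have := g_ge0 j; rewrite le_eqVlt => /orP[/eqP <-|gj0].
    by rewrite powR0 ?mul0r // gt_eqF.
  by rewrite -powRD ?(gt_eqF gj0) ?implybT // subrKC powRr1 // ltW.
have -> : \sum_j g 0 j = 1 - b * n%:R by move: sum1; lra.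
rewrite powRM //.
have bb : powR b alpha * powR b (1 - alpha) = b.
  by rewrite -powRD ?(gt_eqF b_gt0) ?implybT // subrKC powRr1.
have -> : powR 2%:R alpha * powR b alpha / (2%:R * b) *
      (b * (powR b (1 - alpha) * n%:R)) =
    powR 2%:R alpha / 2%:R * (powR b alpha * powR b (1 - alpha)) * n%:R.
  by field; rewrite gt_eqF.
by rewrite bb; ring.
Qed.

(** The flat block contributes [b] times the trace of [(1 + Z) (1 + W)], whose cross terms are
    traceless; the remaining weight sums to [1]. *)
Lemma chi_square_tilted n p b (g : 'rV[R]_p) (Z W : 'M[R]_n) :
  \tr Z = 0 -> \tr W = 0 -> 0 < b -> b * n%:R + \sum_i g 0 i = 1 ->
  \tr (tilted b g Z *m diag_mx (map_mx GRing.inv (flat_row n b g)) *m tilted b g W)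
    = 1 + b * \tr (Z *m W).
Proof.
move=> Z0 W0 b_gt0 sum1.
have -> : map_mx GRing.inv (flat_row n b g) = flat_row n b^-1 (map_mx GRing.inv g).
  by rewrite /flat_row map_row_mx map_const_mx.
rewrite diag_flat_row /tilted !mulmx_block !(mulmx0, mul0mx, addr0, add0r).
rewrite mxtrace_block !mulmx_diag mxtrace_diag -!scalemxAl -!scalemxAr mulmx1.
rewrite -!scalemxAl !linearZ /= mulmxDl !mulmxDr !mul1mx mulmx1 !linearD /= Z0 W0 mxtrace1.
rewrite (eq_bigr (fun i => g 0 i)) => [|j _]; last first.
  (* The inverse of [0] is [0], so null coordinates contribute nothing. *)
  rewrite !mxE; have [->|gj] := eqVneq (g 0 j) 0; first by rewrite mulr0.
  by rewrite mulfV // mul1r.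
by rewrite mulVKf ?gt_eqF // addr0 add0r mulrDr addrAC sum1.
Qed.

End HardFamily.

(** * The two sample lower bounds *)

Section LowerBounds.
Variable R : realType.
Local Notation C := R[i].
Local Notation cmx := (map_mx (real_complex R)).
Local Notation Re := (@complex.Re R).

(** Young's inequality for [2 ^ alpha] and [1], with exponents [1 / alpha] and [1 / (1 - alpha)]. *)
Lemma powR2_le (alpha : R) : 0 < alpha < 1 -> powR 2%:R alpha <= 1 + alpha.
Proof.
move=> /andP[a0 a1].
have := @conjugate_powR R (powR 2%:R alpha) 1 alpha^-1 (1 - alpha)^-1.
rewrite !invrK mulr1 powR1 mul1r -powRrM mulfV ?gt_eqF // powRr1 //.
rewrite powR_ge0 ler01 !invr_gt0 a0 subr_gt0 a1 subrKC => /(_ isT isT isT isT erefl).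
lra.
Qed.

(** The overlap is a multiple of a product [S T] of half sums, and [4 S T <= (S + T) ^ 2] brings in
    the full sum of signs. The bound on the modulus is what allows [n]-th powers to be taken. *)
Lemma flat_overlap_le m (b : R) (F : 'M[R]_m) s t :
  (0 < m)%N -> (forall i j, F i j ^+ 2 = m%:R^-1) ->
  0 <= b -> b * (m + m)%:R <= 1 ->
  `|1 + b * \tr (sign_conj s (reflection F) *m sign_conj t (reflection F))| <=
    expR (b / (m + m)%:R * (\sum_(i < m + m) sgn R s i * sgn R t i) ^+ 2).
Proof.
move=> m_gt0 F2 b_ge0 b_le; rewrite sign_conj_overlap // big_split_ord /=.
set S := \sum_(i < m) sgn R s i * _; set T := \sum_(i < m) _ * sgn R t (m + i).
have sum_le (f : 'I_m -> R) : (forall i, `|f i| = 1) -> `|\sum_i f i| <= m%:R.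
  move=> f1; apply: le_trans (ler_norm_sum _ _ _) _.
  by rewrite (eq_bigr (fun=> 1)) ?sumr_const ?card_ord.
have S_le : `|S| <= m%:R by apply: sum_le => i; rewrite normrM !normr_sgn mulr1.
have T_le : `|T| <= m%:R by apply: sum_le => i; rewrite normrM !normr_sgn mulr1.
have mR_gt0 : 0 < m%:R :> R by rewrite ltr0n.
have ST_le : `|S * T| <= m%:R * m%:R by rewrite normrM ler_pM.
move: ST_le; rewrite ler_norml => /andP[ST_lo ST_hi].
set y := b / _ * _.
have yE : y = b / m%:R * ((S + T) ^+ 2 / 2%:R).
  by rewrite /y natrD; field; rewrite gt_eqF //= -natrD pnatr_eq0 -lt0n addn_gt0 m_gt0.
apply: le_trans (expR_ge1Dx y).
have -> : b * (2%:R / m%:R * S * T) = b / m%:R * (2%:R * (S * T)) by ring.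
have bm_ge0 : 0 <= b / m%:R by rewrite divr_ge0.
have bm_le : b / m%:R * (m%:R * m%:R) * 2%:R <= 1.
  have -> : b / m%:R * (m%:R * m%:R) * 2%:R = b * (m + m)%:R.
    by rewrite natrD; field; rewrite gt_eqF.
  exact: b_le.
rewrite ler_norml yE; apply/andP; split.
  have : b / m%:R * (- (m%:R * m%:R)) <= b / m%:R * (S * T) by rewrite ler_wpM2l.
  have : 0 <= b / m%:R * ((S + T) ^+ 2 / 2%:R).
    by rewrite mulr_ge0 // divr_ge0 ?sqr_ge0.
  lra.
rewrite lerD2l ler_wpM2l //; have := sqr_ge0 (S - T); lra.
Qed.

(** [1/16] bounds the exponent left by the sign moment when [32 n b <= 1]; [16/15] lies below the
    [4/3] of [chi_square_bound]. *)
Lemma expR_sixteenth : expR (16%:R^-1 : R) <= 16%:R / 15%:R.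
Proof.
rewrite -[16%:R^-1]opprK expRN -[16%:R / 15%:R]invrK.
rewrite lef_pV2 ?posrE ?expR_gt0 ?invr_gt0 //; last lra.
apply: le_trans (expR_ge1Dx _); lra.
Qed.

Lemma tilted_lower_bound m p (F : 'M[R]_m) (alpha b eps : R) (g : 'rV[R]_p)
    (r n k : nat) (M : 'I_k -> 'M[C]_(((m + m) + p) ^ n)) (est : 'I_k -> R) :
  (0 < m)%N -> (forall i j, F i j ^+ 2 = m%:R^-1) ->
  F *m F^T = 1%:M -> F^T *m F = 1%:M ->
  0 < alpha < 1 -> 0 < b -> (forall i, 0 <= g 0 i) ->
  b * (m + m)%:R + \sum_i g 0 i = 1 ->
  (m + m + \rank (diag_mx g) <= r)%N ->
  eps + eps < b * (m + m)%:R * (1 - powR 2%:R alpha / 2%:R) / (1 - alpha) ->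
  povm M ->
  (forall rho : 'M[C]_((m + m) + p), density rho -> (\rank rho <= r)%N ->
     2%:R / 3%:R <= success_prob M est rho
       (tsallisD alpha rho (cmx (diag_mx (flat_row (m + m) b g)))) eps) ->
  1 < 32%:R * n%:R * b.
Proof.
move=> m_gt0 F2 FF FF' alpha01 b_gt0 g_ge0 sum1 rk gap povmM succ.
have b_ge0 := ltW b_gt0.
have [l lE] : exists l, l = flat_row (m + m) b g by eexists.
rewrite -lE in succ.
have l_ge0 i : 0 <= l 0 i by rewrite lE; exact: flat_row_ge0.
have l1 : \sum_i l 0 i = 1 by rewrite lE sum_flat_row.
pose Z s := sign_conj s (reflection F).
have Zt s : (Z s)^T = Z s by rewrite sign_conj_tr reflection_tr.
have ZZ s : Z s *m Z s = 1%:M by rewrite sign_conjK // reflectionK.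
have Z0 s : \tr (Z s) = 0 by rewrite sign_conj_trace reflection_trace.
(* Every tilted state has value [v], while the known state has value [0] relative to itself. *)
set v := b * _ * _ / _ in gap.
have v_gap : eps + eps < `|0 - v| by rewrite sub0r normrN (lt_le_trans gap) ?ler_norm.
have [N [pN pN1 NE Nnull]] := estimator_effect est povmM v_gap.
pose rho s := cmx (tilted b g (Z s)).
have rank_le (B : 'M[R]_(m + m)) : (\rank (cmx (block_mx B 0 0 (diag_mx g))) <= r)%N.
  by rewrite mxrank_map rank_diag_block_mx (leq_trans _ rk) // leq_add2r rank_leq_row.
have Nq s : 2%:R / 3%:R <= Re (\tr (N *m (rho s ^t n))).
  rewrite -NE /v -(tsallisD_tilted alpha01 (Zt s) (ZZ s) (Z0 s) b_gt0 g_ge0 sum1) -lE.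
  by apply: succ; [exact: density_tilted | exact: rank_le].
(* Square root of the known state and its pseudo-inverse; the tilted states are supported where
   [tau] is invertible. *)
pose tau := diag_mx (map_mx Num.sqrt l).
pose tau' := diag_mx (map_mx (fun x => (Num.sqrt x)^-1) l).
have tauK : tau *m tau = diag_mx l.
  by rewrite mulmx_diag; congr diag_mx; apply/rowP => i; rewrite !mxE -expr2 sqr_sqrtr.
have tauV : tau' *m tau' = diag_mx (map_mx GRing.inv l).
  rewrite mulmx_diag; congr diag_mx; apply/rowP => i.
  by rewrite !mxE -expr2 exprVn sqr_sqrtr.
have tauT : adjmx (cmx tau) = cmx tau by rewrite adjmx_real tr_diag_mx.
have tauT' : adjmx (cmx tau') = cmx tau' by rewrite adjmx_real tr_diag_mx.
have tau_rho s : cmx tau *m cmx tau' *m rho s = rho s.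
  rewrite /rho -!map_mxM; congr (map_mx _ _).
  have -> : tau *m tau' = block_mx 1%:M 0 0
      (diag_mx (map_mx (fun x => Num.sqrt x / Num.sqrt x) g)).
    rewrite mulmx_diag -diag_const_mx -diag_mx_row; congr diag_mx.
    apply/rowP => i; rewrite -(splitK i); case: (split i) => j /=.
      rewrite row_mxEl !mxE lE /flat_row row_mxEl mxE mulfV //.
      by rewrite gt_eqF // sqrtr_gt0.
    by rewrite row_mxEr !mxE lE /flat_row row_mxEr.
  rewrite mulmx_block !(mulmx0, mul0mx, addr0, add0r) mul1mx mulmx_diag.
  congr (block_mx _ _ _ (diag_mx _)); apply/rowP => j; rewrite !mxE.
  have := g_ge0 j; rewrite le_eqVlt => /orP[/eqP <-|gj]; first by rewrite mulr0.
  by rewrite mulfV ?mul1r // gt_eqF // sqrtr_gt0.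
have rhoT s : adjmx (rho s) = rho s.
  by apply: psdmx_adj; have [] := density_tilted (Zt s) (ZZ s) (Z0 s) b_ge0 g_ge0 sum1.
have Np : Re (\tr (N *m ((cmx tau ^t n) *m (cmx tau ^t n)))) <= 1 / 3%:R.
  rewrite ntensmx_mul -{2}tauT; apply: le_trans (Nnull _ _ _) _.
    by rewrite tauT -map_mxM tauK mxtrace_real mxtrace_diag l1.
  rewrite tauT -map_mxM tauK.
  have := succ (cmx (diag_mx l)); rewrite tsallisD_self // => h.
  have : 2%:R / 3%:R <= success_prob M est (cmx (diag_mx l)) 0 eps.
    apply: h; first exact: density_diag.
    by rewrite lE diag_flat_row; exact: rank_le.
  lra.
rewrite ltNge; apply/negP => n_small.
have size_gt0 : (0 < size (bitseqs (m + m)))%N by rewrite size_bitseqs expn_gt0.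
have QT s : adjmx (rho s ^t n) = rho s ^t n by rewrite adjmx_ntens rhoT.
have aT : adjmx (cmx tau ^t n) = cmx tau ^t n by rewrite adjmx_ntens tauT.
have aT' : adjmx (cmx tau' ^t n) = cmx tau' ^t n by rewrite adjmx_ntens tauT'.
have TSQ s : (cmx tau ^t n) *m (cmx tau' ^t n) *m (rho s ^t n) = rho s ^t n.
  by rewrite !ntensmx_mul tau_rho.
have := chi_square_bound size_gt0 pN pN1 aT aT' QT TSQ Np Nq.
apply/negP; rewrite -ltNge.
have mm_gt0 : 0 < (m + m)%:R :> R by rewrite ltr0n addn_gt0 m_gt0.
have bm_le : b * (m + m)%:R <= 1 by rewrite -[X in _ <= X]sum1 lerDl sumr_ge0.
(* The exponent of [flat_overlap_le] after the [n]-th power. *)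
pose a := n%:R * b / (m + m)%:R.
have a_ge0 : 0 <= a by rewrite /a divr_ge0 ?mulr_ge0.
have aE : a * (m + m)%:R = n%:R * b by rewrite /a divfK // gt_eqF.
have term_le s t : Re (\tr ((rho s ^t n) *m ((cmx tau' ^t n) *m (cmx tau' ^t n))
      *m (rho t ^t n))) <=
    expR (a * (0 + \sum_(i < m + m) sgn R t i * sgn R s i) ^+ 2).
  rewrite !ntensmx_mul mxtrace_ntens /rho -!map_mxM tauV lE mxtrace_real.
  rewrite (chi_square_tilted (Z0 s) (Z0 t)) // -rmorphXn /=.
  apply: le_trans (ler_norm _) _; rewrite normrX add0r.
  have -> : a = n%:R * (b / (m + m)%:R) by rewrite /a mulrA.
  rewrite -mulrA expRM_natl; apply: lerXn2r; rewrite ?nnegrE ?expR_ge0 //.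
  under eq_bigr => i _ do rewrite mulrC.
  exact: flat_overlap_le.
set K : R := (size _)%:R.
have K_gt0 : 0 < K by rewrite ltr0n.
have row_le s : \sum_(t <- bitseqs (m + m))
    Re (\tr ((rho s ^t n) *m ((cmx tau' ^t n) *m (cmx tau' ^t n)) *m (rho t ^t n)))
    <= K * (16%:R / 15%:R).
  apply: le_trans (ler_sum _ (fun t _ => term_le s t)) _.
  (* With [s] fixed, only the signs of [t] are averaged, those of [s] playing the part of [w]. *)
  have ak : 32%:R * a * (m + m)%:R <= 1 by rewrite -mulrA aE mulrA.
  have := sum_expR_sqr_le 0 a_ge0 ak (sqr_sgn R s).
  rewrite expr0n mulr0 add0r -natrX -size_bitseqs -/K => /le_trans; apply.
  rewrite ler_wpM2l ?(ltW K_gt0) //; apply: le_trans expR_sixteenth.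
  by rewrite ler_expR -mulrA aE; lra.
apply: le_lt_trans (ler_sum _ (fun s _ => row_le s)) _.
rewrite big_const_seq count_predT iter_addr_0 -mulr_natr -/K; nra.
Qed.

Lemma bernoulli_le (x : R) n : x <= 1 -> 1 - x *+ n <= (1 - x) ^+ n.
Proof.
move=> x1; elim: n => [|n IHn]; first by rewrite mulr0n subr0 expr0.
rewrite exprS; apply: le_trans (ler_wpM2l _ IHn); last by rewrite subr_ge0.
have := mulrn_wge0 n (sqr_ge0 x).
rewrite mulrSr -[_ ^+ 2 *+ n]mulr_natr -[x *+ n]mulr_natr; lra.
Qed.

(** The matrix [sigma ^ (1 - alpha)] kills the null coordinate, so a unit vector with coordinates
    [c] and [s] has a value depending only on [c ^ 2]. The two states compared exchange these
    coordinates. *)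
Lemma pure_lower_bound d (l : 'rV[R]_d) (i0 i1 : 'I_d) (alpha eps : R)
    (r n k : nat) (M : 'I_k -> 'M[C]_(d ^ n)) (est : 'I_k -> R) :
  i0 != i1 -> (forall i, 0 <= l 0 i) -> 3%:R / 8%:R <= l 0 i0 <= 1 -> l 0 i1 = 0 ->
  0 < alpha < 1 -> 0 < eps < 16%:R^-1 -> (0 < r)%N -> povm M ->
  (forall rho : 'M[C]_d, density rho -> (\rank rho <= r)%N ->
     2%:R / 3%:R <= success_prob M est rho
       (tsallisD alpha rho (cmx (diag_mx l))) eps) ->
  1000%:R^-1 <= n%:R * eps ^+ 2.
Proof.
move=> i01 l_ge0 /andP[l0_lo l0_hi] li1 /andP[a0 a1] /andP[e0 e1] r_gt0 povmM succ.
pose V (c s : R) : 'cV[R]_d := c *: delta_mx i0 0 + s *: delta_mx i1 0.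
have VV c s c' s' : (V c s)^T *m V c' s' = (c * c' + s * s')%:M.
  have -> : (V c s)^T = c *: delta_mx 0 i0 + s *: delta_mx 0 i1.
    by apply/matrixP => x y; rewrite !mxE ![(y == _) && _]andbC.
  rewrite /V mulmxDl !mulmxDr.
  rewrite -!scalemxAl -!scalemxAr !mul_delta_mx_cond eqxx (negbTE i01).
  rewrite eq_sym (negbTE i01) !mulr0n !scaler0 addr0 add0r !scalerA.
  by rewrite eqxx !mulr1n; apply/matrixP => x y; rewrite !ord1 !mxE !mulr1.
pose P c s := V c s *m (V c s)^T.
have PE c s : cmx (P c s) = cmx (V c s) *m adjmx (cmx (V c s)).
  by rewrite adjmx_real -map_mxM.
have Ptr c s : c ^+ 2 + s ^+ 2 = 1 -> \tr (cmx (P c s)) = 1.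
  move=> cs; rewrite mxtrace_real /P mxtrace_mulC VV -!expr2 cs.
  by rewrite mxtrace1.
have P_succ c s : c ^+ 2 + s ^+ 2 = 1 -> 2%:R / 3%:R <= success_prob M est
    (cmx (P c s)) ((1 - c ^+ 2 * powR (l 0 i0) (1 - alpha)) / (1 - alpha)) eps.
  move=> cs.
  have -> : (1 - c ^+ 2 * powR (l 0 i0) (1 - alpha)) / (1 - alpha) =
      tsallisD alpha (cmx (P c s)) (cmx (diag_mx l)).
    rewrite /tsallisD mxpowR_diag // (@mxpowR_scaled_proj _ _ _ 1) //; first last.
    - by rewrite gt_eqF.
    - rewrite -map_mxM scale1r; congr (map_mx _ _).
      by rewrite /P mulmxA -(mulmxA (V c s)) VV -!expr2 cs mulmx1.
    - by rewrite adjmx_real /P trmx_mul trmxK.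
    rewrite powR1 divr1 scale1r -map_mxM mxtrace_real /=; congr ((1 - _) / _).
    rewrite /P -mulmxA mxtrace_mulC.
    set w := map_mx _ l.
    have w0 : w 0 i0 = powR (l 0 i0) (1 - alpha) by rewrite mxE.
    have w1 : w 0 i1 = 0 by rewrite mxE li1 powR0 // gt_eqF // subr_gt0.
    clearbody w.
    have -> : (V c s)^T *m diag_mx w = (V (c * w 0 i0) (s * w 0 i1))^T.
      apply/matrixP => x y; rewrite mul_mx_diag !ord1 !mxE eqxx !andbT.
      have [->|yi0] := eqVneq y i0; first by rewrite (negbTE i01) /=; ring.
      by have [->|yi1] := eqVneq y i1 => /=; ring.
    by rewrite VV w0 w1 mxtrace_scalar mulr1n; ring.
  apply: succ.
    by split; [rewrite PE; exact: psdmx_gram | exact: Ptr].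
  by rewrite mxrank_map (leq_trans (mxrankM_maxl _ _)) // (leq_trans (rank_leq_col _)).
(* The offset [3 eps] makes the values differ by [6 eps L / (1 - alpha)], which exceeds [2 eps] as
   [L >= 3/8]. *)
pose hi := Num.sqrt (2%:R^-1 + 3%:R * eps); pose lo := Num.sqrt (2%:R^-1 - 3%:R * eps).
have hi2 : hi ^+ 2 = 2%:R^-1 + 3%:R * eps by rewrite sqr_sqrtr //; lra.
have lo2 : lo ^+ 2 = 2%:R^-1 - 3%:R * eps by rewrite sqr_sqrtr //; lra.
have hilo : hi ^+ 2 + lo ^+ 2 = 1 by rewrite hi2 lo2; lra.
have lohi : lo ^+ 2 + hi ^+ 2 = 1 by rewrite hi2 lo2; lra.
set L := powR (l 0 i0) (1 - alpha) in P_succ.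
have L_ge : 3%:R / 8%:R <= L.
  apply: (le_trans l0_lo); apply: ger1_powR; last by rewrite gerBl ltW.
  by rewrite l0_hi andbT (lt_le_trans _ l0_lo) ?divr_gt0.
set v1 := (1 - hi ^+ 2 * L) / (1 - alpha); set v2 := (1 - lo ^+ 2 * L) / (1 - alpha).
have gap : eps + eps < `|v1 - v2|.
  rewrite distrC; apply: lt_le_trans (ler_norm _).
  have -> : v2 - v1 = (hi ^+ 2 - lo ^+ 2) * L / (1 - alpha) by rewrite /v1 /v2; ring.
  rewrite ltr_pdivlMr ?subr_gt0 // hi2 lo2; nra.
have [N [pN pN1 NE Nnull]] := estimator_effect est povmM gap.
pose X := cmx (V hi lo) ^t n; pose Y := cmx (V lo hi) ^t n.
have dotE c s c' s' : Re (\tr (adjmx (cmx (V c s) ^t n) *m (cmx (V c' s') ^t n))) =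
    (c * c' + s * s') ^+ n.
  rewrite adjmx_ntens ntensmx_mul mxtrace_ntens adjmx_real -map_mxM VV mxtrace_real.
  by rewrite mxtrace_scalar mulr1n -rmorphXn.
have NV c s : Re (\tr (adjmx (cmx (V c s) ^t n) *m N *m (cmx (V c s) ^t n))) =
    Re (\tr (N *m (cmx (P c s) ^t n))).
  by rewrite -mulmxA mxtrace_mulC -mulmxA adjmx_ntens ntensmx_mul PE.
have overlap : Re (\tr (adjmx X *m Y)) <= 17%:R / 18%:R.
  apply: (@fidelity_bound _ _ _ N) => //.
  - by rewrite dotE -!expr2 hilo expr1n.
  - by rewrite dotE -!expr2 lohi expr1n.
  - rewrite NV PE; apply: le_trans (Nnull _ _ _) _; first by rewrite -PE Ptr.
    by rewrite -PE; have := P_succ _ _ hilo; rewrite -/v1; lra.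
  - by rewrite NV -NE; exact: P_succ.
rewrite dotE (mulrC lo hi) -mulr2n in overlap.
have o_ge0 : 0 <= (hi * lo) *+ 2 by rewrite mulrn_wge0 // mulr_ge0 ?sqrtr_ge0.
have o2 : ((hi * lo) *+ 2) ^+ 2 = 1 - 36%:R * eps ^+ 2.
  by rewrite -mulr_natl !exprMn hi2 lo2; field.
have eps2 : 36%:R * eps ^+ 2 <= 1 by nra.
have := bernoulli_le n eps2.
(* Squaring the overlap removes its root; Bernoulli's inequality then gives
   [36 n eps ^ 2 >= 1 - (17/18) ^ 2]. *)
have on2 : (1 - 36%:R * eps ^+ 2) ^+ n <= (17%:R / 18%:R) ^+ 2.
  rewrite -o2 -exprM mulnC exprM lerXn2r ?nnegrE ?exprn_ge0 //; lra.
rewrite -[_ * _ *+ n]mulr_natr; lra.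
Qed.

End LowerBounds.

(** * Spectrum and rank of the known state outside the flat block *)

Section KnownState.
Variable R : realType.

Definition tail_row q (top b : R) : 'rV[R]_(q.+1 + 1) :=
  row_mx (\row_(j < q.+1) if j == ord0 then top else b) (0 : 'rV_1).

Lemma tail_row_ge0 q (top b : R) : 0 <= top -> 0 <= b ->
  forall i, 0 <= tail_row q top b 0 i.
Proof.
move=> top_ge0 b_ge0 i; rewrite /tail_row -(splitK i).
case: (split i) => j /=; rewrite ?row_mxEl ?row_mxEr mxE //.
by case: ifP.
Qed.

Lemma sum_tail_row q (top b : R) : \sum_i tail_row q top b 0 i = top + b * q%:R.
Proof.
rewrite big_split_ord /= [X in _ + X]big1 => [|j _]; last by rewrite row_mxEr mxE.
rewrite addr0 big_ord_recl row_mxEl mxE eqxx; congr (_ + _).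
rewrite (eq_bigr (fun=> b)) => [|j _]; last by rewrite row_mxEl mxE.
by rewrite sumr_const card_ord mulr_natr.
Qed.

Lemma rank_diag_pos n (h : 'rV[R]_n) : (forall j, 0 < h 0 j) -> \rank (diag_mx h) = n.
Proof.
move=> h_gt0; apply: mxrank_unit; rewrite unitmxE det_diag unitfE.
by apply/prodf_neq0 => j _; rewrite gt_eqF.
Qed.

Lemma rank_tail_row q (top b : R) : 0 < top -> 0 < b ->
  \rank (diag_mx (tail_row q top b)) = q.+1.
Proof.
move=> top_gt0 b_gt0; rewrite /tail_row diag_mx_row rank_diag_block_mx.
rewrite linear0 mxrank0 addn0 rank_diag_pos // => j.
by rewrite mxE; case: ifP.
Qed.

End KnownState.

(* The support of [sigma] is a flat block of size [m + m], a coordinate of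
   constant weight and [q] further coordinates; one coordinate is null. *)
Lemma split_rank r : (0 < r)%N -> exists m q : nat,
  r = (m + m + q.+1)%N /\
  ((r <= 2)%N /\ m = 0%N \/ (0 < m)%N /\ (r <= 4 * m)%N /\ exists k, m = (2 ^ k)%N).
Proof.
move=> r_gt0; have [r_small|r_big] := leqP r 2.
  by exists 0%N, r.-1; split; [lia | left].
(* [2 m] will be the largest power of two not above [r - 1], so [2 m <= r - 1 < 4 m], and [q] takes
   up the rest. *)
have t_gt0 : (0 < trunc_log 2 r.-1)%N by rewrite trunc_log_gt0; lia.
have /andP[] : (2 ^ trunc_log 2 r.-1 <= r.-1 < 2 ^ (trunc_log 2 r.-1).+1)%N.
  by apply: trunc_log_bounds => //; lia.
case: (trunc_log 2 r.-1) t_gt0 => // t _; rewrite !expnS => lo hi.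
exists (2 ^ t)%N, (r.-1 - 2 * 2 ^ t)%N; split; first by lia.
by right; split; [rewrite expn_gt0 | split; [lia | exists t]].
Qed.

Theorem mainTheorem12 (R : realType) (alpha : R) :
  0 < alpha < 1 ->
  exists c : R, 0 < c /\
  forall (r : nat) (eps : R),
    (0 < r)%N -> 0 < eps < alpha * (1 - alpha) / 4%:R ->
    exists (d : nat) (sigma : 'M[R[i]]_d),
      density sigma /\ \rank sigma = r /\
      forall (n k : nat) (M : 'I_k -> 'M[R[i]]_(d ^ n)) (est : 'I_k -> R),
        povm M ->
        (forall rho : 'M[R[i]]_d, density rho -> (\rank rho <= r)%N ->
           2%:R / 3%:R <= success_prob M est rho (tsallisD alpha rho sigma) eps) ->
        c * (r%:R / eps + 1 / eps ^+ 2) <= n%:R.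
Proof.
(* Both [r / eps] and [1 / eps ^ 2] will be bounded by [1000 n]. *)
move=> alpha01; exists 2000%:R^-1; split=> [|r eps r_gt0 /andP[e_gt0 e_lt]].
  by rewrite invr_gt0.
have /andP[a0 a1] := alpha01.
have e16 : eps < 16%:R^-1 by have := sqr_ge0 (alpha - 2%:R^-1); lra.
have [m [q [rE m_case]]] := split_rank r_gt0.
(* A flat block of total weight [5 eps] gives a value of at least [5/2 eps], above the needed
   [2 eps]. Without a flat block, [1/4] is a small enough constant weight. *)
pose b : R := if m is 0 then 4%:R^-1 else 5%:R * eps / (m + m)%:R.
have b_gt0 : 0 < b.
  rewrite /b; case: (m) => [|j]; first by rewrite invr_gt0.
  by rewrite divr_gt0 ?mulr_gt0.
(* For [m > 0], [2 m + q <= 4 m] bounds the weight by [10 eps], and [eps < 1/16]; this leaves at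
   least [3/8] for [top]. *)
have bsum : (m + m + q)%:R * b <= 5%:R / 8%:R.
  case: m_case => [[r2 m0]|[m_gt0 [r4m _]]].
    have : (m + m + q)%:R <= 1 :> R by rewrite (ler_nat R _ 1); lia.
    by rewrite /b m0 /=; lra.
  have bE : b * m%:R = 5%:R / 2%:R * eps.
    rewrite /b; case: (m) m_gt0 => // j _; rewrite natrD; field.
    by apply: lt0r_neq0; have := ler0n R j; lra.
  have : (m + m + q)%:R <= 4%:R * m%:R :> R by rewrite -natrM ler_nat; lia.
  move=> /(ler_wpM2r (ltW b_gt0)); rewrite -mulrA [m%:R * b]mulrC bE; lra.
pose top : R := 1 - (m + m + q)%:R * b.
have top_ge : 3%:R / 8%:R <= top by rewrite /top; lra.
have top_gt0 : 0 < top by lra.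
pose g := tail_row q top b.
have g_ge0 i : 0 <= g 0 i by apply: tail_row_ge0; exact: ltW.
have sum1 : b * (m + m)%:R + \sum_i g 0 i = 1.
  by rewrite sum_tail_row /top [in X in 1 - X]natrD; ring.
pose l := flat_row (m + m) b g.
have l_ge0 i : 0 <= l 0 i by apply: flat_row_ge0 => //; exact: ltW.
exists ((m + m) + (q.+1 + 1))%N, (map_mx (real_complex R) (diag_mx l)).
split; first by apply: density_diag; rewrite ?sum_flat_row.
split.
  rewrite mxrank_map /l /flat_row diag_mx_row rank_diag_block_mx rank_tail_row //.
  by rewrite rank_diag_pos // => j; rewrite mxE.
move=> n k M est povmM succ.
have pure : 1000%:R^-1 <= n%:R * eps ^+ 2.
  apply: (pure_lower_bound (i0 := rshift _ (lshift 1 ord0))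
    (i1 := rshift _ (rshift q.+1 ord0)) _ l_ge0 _ _ alpha01 _ r_gt0 povmM succ).
  - by rewrite (inj_eq (@rshift_inj _ _)) eq_lrshift.
  - rewrite /l /flat_row row_mxEr /g /tail_row row_mxEl mxE eqxx top_ge.
    by rewrite /top gerBl mulr_ge0 // ltW.
  - by rewrite /l /flat_row row_mxEr /g /tail_row row_mxEr mxE.
  - by rewrite e_gt0.
have e_inv : eps * eps^-1 = 1 by rewrite mulfV // gt_eqF.
have x_gt0 : 0 < eps^-1 by rewrite invr_gt0.
have -> : r%:R / eps + 1 / eps ^+ 2 = r%:R * eps^-1 + eps^-1 ^+ 2 by rewrite exprVn div1r.
have pure' : 1000%:R^-1 * eps^-1 ^+ 2 <= n%:R.
  have := ler_wpM2r (sqr_ge0 eps^-1) pure.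
  by rewrite -mulrA -exprMn e_inv expr1n mulr1.
suff : r%:R * eps^-1 <= 1000%:R * n%:R by lra.
case: m_case => [[r2 m0]|[m_gt0 [r4m [t mE]]]].
  (* For [r <= 2] the pure-state bound suffices, since [1 / eps > 16] makes [2 / eps] at most
     [1 / (8 eps ^ 2)]. *)
  have r2' : r%:R <= 2%:R :> R by rewrite ler_nat.
  have : r%:R * eps^-1 <= 2%:R * eps^-1 by rewrite ler_wpM2r // ltW.
  have : 16%:R < eps^-1 by rewrite -[16%:R]invrK ltf_pV2 ?posrE ?invr_gt0.
  nra.
move: (flat_orthogonal R t); rewrite -mE => -[F [F2 FF FF']].
have bE : b * (m + m)%:R = 5%:R * eps.
  by rewrite /b; case: (m) m_gt0 => // j _; rewrite divfK // pnatr_eq0 addnS.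
have gap : eps + eps < b * (m + m)%:R * (1 - powR 2%:R alpha / 2%:R) / (1 - alpha).
  rewrite bE ltr_pdivlMr ?subr_gt0 //; have := powR2_le alpha01; nra.
have rk : (m + m + \rank (diag_mx g) <= r)%N by rewrite rank_tail_row // rE.
have := tilted_lower_bound m_gt0 F2 FF FF' alpha01 b_gt0 g_ge0 sum1 rk gap povmM succ.
have mR : 0 < m%:R :> R by rewrite ltr0n.
have r4m' : r%:R <= 4%:R * m%:R :> R by rewrite -natrM ler_nat.
have bE' : b * m%:R = 5%:R / 2%:R * eps by move: bE; rewrite natrD; lra.
(* Multiplying [1 < 32 n b] by [m] and using [b m = 5/2 eps]; with [r <= 4 m] this gives
   [r / eps <= 320 n]. *)
move=> nb; have : m%:R <= 80%:R * n%:R * eps.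
  have := ler_wpM2r (ltW mR) (ltW nb); rewrite -(mulrA _ b) bE'; lra.
move=> /(ler_wpM2r (ltW x_gt0)); rewrite -(mulrA _ eps) e_inv => mle.
have := ler_wpM2r (ltW x_gt0) r4m'; have := ler0n R n; lra.
Qed.
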